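(* Let $G$ be a finite simple graph without isolated vertices on $n\ge 1$ vertices, and let $\Gamma^2_G$ be the Stanley--Reisner complex of the polarization of $I(G)^2$. Then $$\dim(\Gamma^2_G)\ge n.$$ Moreover, $\Gamma^2_G$ is pure if and only if $G$ is unmixed and contains no triangle; and when $\Gamma^2_G$ is pure, its dimension is $n+\alpha(G)-1$.
   Context: Let $K$ be a field. For a finite simple graph $G$ with vertex set $V$ and edge set $E(G)$, the edge ideal $I(G)\subseteq K[v : v\in V]$ is generated by the monomials $vw$ with $\{v,w\}\in E(G)$. The polarization of a monomial $m=\prod_v v^{e_v}$ is $\mathcal{P}(m)=\prod_v v_1v_2\cdots v_{e_v}$, and the polarization of a monomial ideal is generated by the polarizations of its minimal monomial generators. The polarization $\mathcal{P}(I(G)^2)$ is regarded as an ideal in the polynomial ring over $K$ in the $2|V|$ variables $v_1,v_2$ ($v\in V$). $\Gamma^2_G$ is its Stanley--Reisner complex: its faces are the subsets $\sigma\subseteq\{v_1,v_2 : v\in V\}$ such that the product of the variables in $\sigma$ is not in $\mathcal{P}(I(G)^2)$. The dimension of a simplicial complex is the largest cardinality of a face minus $1$; it is pure if all its facets (maximal faces) have the same cardinality. The independence number $\alpha(G)$ is the largest cardinality of an independent set (set of pairwise non-adjacent vertices) of $G$; $G$ is unmixed if all its inclusion-maximal independent sets have the same cardinality. A triangle is a set of three pairwise adjacent vertices. *)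

(* Defs.v *)
From HB Require Import structures.
From mathcomp Require Import all_boot all_order all_algebra.
From mathcomp Require Import finmap.
From mathcomp.classical Require Import boolp.
From mathcomp.multinomials Require Import monalg.

Set Implicit Arguments.
Unset Strict Implicit.
Unset Printing Implicit Defensive.

Import GRing.Theory.
Local Open Scope ring_scope.

Section Ideals.
Variable R : comNzRingType.
Implicit Types I J S : R -> Prop.

Definition ideal_gen S : R -> Prop := fun f =>
  exists s : seq (R * R),
    (forall p, p \in s -> S p.2) /\ f = \sum_(p <- s) p.1 * p.2.

Definition ideal_mul I J : R -> Prop :=
  ideal_gen (fun h => exists f g, [/\ I f, J g & h = f * g]).

End Ideals.

(* The polynomial ring R[v : v in V]: {cmonom V} is the free commutative
   monoid on V, and m v is the exponent of v in the monomial m. *)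
Notation polyring R V := {malg R[{cmonom V}]}.

Section Monomials.
Variables (K : fieldType) (V : finType).
Implicit Types (v : V) (m d : {cmonom V}) (J : polyring K V -> Prop).

Definition mono m : polyring K V := << m >>.

Definition var v : polyring K V := mono (ucm v).

Definition mono_dvd d m : Prop := exists c : {cmonom V}, m = mmul d c.

Definition min_mono_gen J m : Prop :=
  J (mono m) /\ forall d, J (mono d) -> mono_dvd d m -> d = m.

End Monomials.

Section Polarization.
Variables (K : fieldType) (V : finType) (k : nat).

(* The variable v_j (1 <= j <= k) is encoded as the pair (v, j - 1).  This is
   the polarization of m when all exponents of m are at most k. *)
Definition polarize_mono (m : {cmonom V}) : polyring K (V * 'I_k)%type :=
  \prod_(v : V) \prod_(j < k | (j < m v)%N) var K (v, j).

Definition polarization (J : polyring K V -> Prop) :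
    polyring K (V * 'I_k)%type -> Prop :=
  ideal_gen (fun f => exists2 m, min_mono_gen J m & f = polarize_mono m).

End Polarization.

Section Complexes.
Variable W : finType.
Implicit Types D : {set {set W}}.

Definition stanley_reisner (K : fieldType) (J : polyring K W -> Prop) :
    {set {set W}} :=
  [set s : {set W} | `[< ~ J (\prod_(w in s) var K w) >]].

Definition complex_dim D : int := (\max_(s in D) #|s|)%N%:Z - 1.

Definition facet D (s : {set W}) : bool := maxset (fun t => t \in D) s.

Definition pure D : Prop :=
  forall s t, facet D s -> facet D t -> #|s| = #|t|.

End Complexes.

Section Graphs.
Variables (V : finType) (e : rel V).

Definition simple_graph : Prop := symmetric e /\ irreflexive e.

Definition no_isolated_vertex : Prop := forall v, exists w, e v w.

Definition independent (S : {set V}) : bool :=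
  [forall v in S, forall w in S, ~~ e v w].

Definition independence_number : nat := \max_(S | independent S) #|S|.

Definition unmixed : Prop :=
  forall S T, maxset independent S -> maxset independent T -> #|S| = #|T|.

Definition has_triangle : Prop :=
  exists x y z, [/\ e x y, e y z & e x z].

Definition edge_ideal (K : fieldType) : polyring K V -> Prop :=
  ideal_gen (fun f => exists v w, e v w /\ f = var K v * var K w).

(* Minimal generators of I(G)^2 are products of two edge monomials, which are
   squarefree, so their exponents are at most 2 and polarizing with two copies
   of each vertex loses nothing. *)
Definition polarized_square_complex (K : fieldType) :
    {set {set (V * 'I_2)}} :=
  let I := edge_ideal (K := K) in
  stanley_reisner (polarization (k := 2) (ideal_mul I I)).

End Graphs.

(* Main.v *)
(* A set s of variables has two layers, S_j = {v | v_j in s}.  Since all minimal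
   generators of I(G)^2 are products of two edges, s is a face iff any two
   (possibly equal) edges of G[S_1] share a vertex outside S_2.  Hence the core
   S_1 :&: S_2 is independent, and |s| = |S_1 :|: S_2| + |S_1 :&: S_2| is at most
   n + alpha(G), which is attained at S_1 maximum independent, S_2 = V; more
   generally S_1 maximal independent and S_2 = V give a facet.
   If G has no triangle, then the edges of G[S_1] form a star, so that a facet
   has |V \ S_2| <= 1 and its core is a maximal independent set.
   If abc is a triangle, then a facet containing S_1 = {a,b,c} and
   S_2 = V \ {a,b,c} is too small, as its core remains independent after adding
   the new vertex a. *)
Require Import Defs.
From mathcomp Require Import all_boot all_order all_algebra.
From mathcomp Require Import finmap.
From mathcomp.classical Require Import boolp.
From mathcomp.multinomials Require Import monalg.

Set Implicit Arguments.
Unset Strict Implicit.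
Unset Printing Implicit Defensive.

Import GRing.Theory Num.Theory.
Local Open Scope ring_scope.

(** * Generated ideals, supports and squarefree monomials *)

Section MonomialIdeals.
Variables (K : fieldType) (V : finType).
Implicit Types (m c d : {cmonom V}) (s t : {set V}).

Lemma ideal_gen_incl (R : comNzRingType) (S : R -> Prop) f :
  S f -> ideal_gen S f.
Proof.
move=> Sf; exists [:: (1, f)]; split; last by rewrite big_seq1 mul1r.
by move=> p; rewrite inE => /eqP->.
Qed.

Lemma ideal_genMl (R : comNzRingType) (S : R -> Prop) g f :
  ideal_gen S f -> ideal_gen S (g * f).
Proof.
case=> s [sS ->]; exists [seq (g * p.1, p.2) | p <- s]; split.
  by move=> _ /mapP[p /sS Sp ->].
by rewrite big_map mulr_sumr; apply: eq_bigr => p _; rewrite mulrA.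
Qed.

Lemma monoM m d : mono K (mmul m d) = mono K m * mono K d.
Proof. by rewrite /mono malgM_def fgmulUU mulr1. Qed.

Lemma mono1 : mono K (mone : {cmonom V}) = 1.
Proof. by []. Qed.

Lemma mem_msupp_mono m d : (d \in msupp (mono K m)) = (d == m).
Proof. by rewrite msuppU1 in_fset1. Qed.

(** Cancellation only removes monomials, so each monomial of a combination of generators is a
    multiple of a monomial of some generator. With [P] a divisibility condition, this decides which
    monomials an ideal contains. *)
Lemma ideal_gen_msupp (S : polyring K V -> Prop) (P : {cmonom V} -> Prop) :
    (forall c m, P m -> P (mmul c m)) ->
    (forall f, S f -> forall m, m \in msupp f -> P m) ->
  forall f, ideal_gen S f -> forall m, m \in msupp f -> P m.
Proof.
move=> Pup PS _ [s [sS ->]]; elim: s sS => [|p s IHs] sS m.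
  by rewrite big_nil msupp0 in_fset0.
rewrite big_cons => /(fsubsetP (msuppD_le _ _)); rewrite in_fsetU => /orP[].
  case/msuppM_le=> c [d [_ dp ->]]; apply: Pup.
  by apply: PS dp; apply: sS; rewrite mem_head.
by apply: IHs => q qs; apply: sS; rewrite inE qs orbT.
Qed.

Definition squarefree_monom s : {cmonom V} := \big[mmul/mone]_(w in s) ucm w.

Lemma mono_squarefree s : mono K (squarefree_monom s) = \prod_(w in s) var K w.
Proof. by apply: (big_morph _ monoM mono1). Qed.

Lemma squarefree_monomE s w : squarefree_monom s w = (w \in s).
Proof.
have h m d : cmonom_val (mmul m d) w = (m w + d w)%N by exact: cmM.
rewrite /squarefree_monom (big_morph (fun m : {cmonom V} => m w) h (cm1 w)).
under eq_bigr do rewrite cmU.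
have [ws|ws] := boolP (w \in s).
  rewrite (bigD1 w) //= eqxx big1 // => v /andP[_ vw].
  by rewrite (negbTE vw).
by rewrite big1 // => v vs; case: eqP => // vw; rewrite -vw vs in ws.
Qed.

Lemma squarefree_monom_dvd s t : s \subset t ->
  exists f, mono K (squarefree_monom t) = f * mono K (squarefree_monom s).
Proof.
move=> st; exists (mono K (squarefree_monom (t :\: s))).
by rewrite !mono_squarefree (big_setID s) /= (setIidPr st) mulrC.
Qed.

End MonomialIdeals.

(** * Polarization in terms of sets of variables *)

Section PolarizedMonomials.
Variables (K : fieldType) (V : finType) (k : nat).
Implicit Types (m : {cmonom V}) (s : {set V * 'I_k}).

Definition polar_support m : {set V * 'I_k} :=
  [set w : V * 'I_k | (w.2 < m w.1)%N].

Lemma polarize_monoE m :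
  polarize_mono K k m = mono K (squarefree_monom (polar_support m)).
Proof.
rewrite mono_squarefree /polarize_mono pair_big_dep /=.
by apply: eq_big => [[v j]|[v j]] //; rewrite !inE.
Qed.

(** A monomial lies in a monomial ideal only if a generator divides it, and divisibility of
    squarefree monomials is inclusion of their sets of variables. *)
Lemma polarization_squarefreeP (J : polyring K V -> Prop) s :
  polarization J (\prod_(w in s) var K w) <->
  exists2 m, min_mono_gen J m & polar_support m \subset s.
Proof.
rewrite -mono_squarefree; split=> [Js|[m Jm ms]]; last first.
  have [f ->] := squarefree_monom_dvd K ms; apply: ideal_genMl.
  by apply: ideal_gen_incl; exists m => //; rewrite polarize_monoE.
pose P (d : {cmonom (V * 'I_k)%type}) := exists2 m, min_mono_gen J m &
  forall w, w \in polar_support m -> (0 < d w)%N.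
have [|||m Jm ms] := ideal_gen_msupp (P := P) _ _ Js (m := squarefree_monom s).
- move=> c d [m Jm md]; exists m => // w /md d_gt0.
  by rewrite cmM ltn_addl.
- move=> f [m Jm ->] d; rewrite polarize_monoE mem_msupp_mono => /eqP->.
  by exists m => // w wm; rewrite squarefree_monomE wm.
- by rewrite mem_msupp_mono.
exists m => //; apply/subsetP => w /ms.
by rewrite squarefree_monomE; case: (w \in s).
Qed.

End PolarizedMonomials.

(** * Minimal monomial generators of the squared edge ideal *)

Section SquareOfEdgeIdeal.
Variables (K : fieldType) (V : finType) (e : rel V).

Definition edge_monom (a b : V) : {cmonom V} := mmul (ucm a) (ucm b).

Definition two_edges_monom (a b c d : V) : {cmonom V} :=
  mmul (edge_monom a b) (edge_monom c d).

Lemma two_edges_monomE a b c d v :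
  two_edges_monom a b c d v =
  ((a == v) + (b == v) + ((c == v) + (d == v)))%N.
Proof. by rewrite !cmM !cmU. Qed.

Lemma mdeg_two_edges a b c d : mdeg (two_edges_monom a b c d) = 4%N.
Proof. by rewrite !mdegM !mdegU. Qed.

Lemma mono_dvd_mulr (d c m : {cmonom V}) : mono_dvd d m -> mono_dvd d (mmul c m).
Proof. by case=> x ->; exists (mmul c x); rewrite mulmA (mulmC c d) -mulmA. Qed.

Let I := edge_ideal e (K := K).

Lemma edge_ideal_msupp f m :
  I f -> m \in msupp f -> exists a b, e a b /\ mono_dvd (edge_monom a b) m.
Proof.
move=> If; move: f If m; apply: ideal_gen_msupp.
  move=> c m [a [b [ab /(mono_dvd_mulr c) abm]]]; by exists a, b.
move=> f [a [b [ab ->]]] m; rewrite -monoM mem_msupp_mono => /eqP->.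
by exists a, b; split=> //; exists mone; rewrite mulm1.
Qed.

Lemma edge_ideal_square_msupp f m :
  ideal_mul I I f -> m \in msupp f ->
  exists a b c d, [/\ e a b, e c d & mono_dvd (two_edges_monom a b c d) m].
Proof.
move=> If; move: f If m; apply: ideal_gen_msupp.
  move=> x m [a [b [c [d [ab cd /(mono_dvd_mulr x) h]]]]].
  by exists a, b, c, d.
move=> _ [f [g [If Ig ->]]] m /msuppM_le[m1 [m2 [m1f m2g ->]]].
have [a [b [ab [x ->]]]] := edge_ideal_msupp If m1f.
have [c [d [cd [y ->]]]] := edge_ideal_msupp Ig m2g.
exists a, b, c, d; split=> //; exists (mmul x y).
rewrite /two_edges_monom; move: (edge_monom a b) (edge_monom c d) => u w.
by rewrite !mulmA -(mulmA u) (mulmC x) !mulmA.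
Qed.

Lemma two_edges_in_square a b c d :
  e a b -> e c d -> ideal_mul I I (mono K (two_edges_monom a b c d)).
Proof.
move=> ab cd; apply: ideal_gen_incl.
exists (mono K (edge_monom a b)), (mono K (edge_monom c d)); split.
- by apply: ideal_gen_incl; exists a, b; rewrite monoM.
- by apply: ideal_gen_incl; exists c, d; rewrite monoM.
- exact: monoM.
Qed.

(* All the monomials [two_edges_monom a b c d] have degree 4, so none of them
   properly divides another. *)
Lemma min_mono_gen_squareP m :
  min_mono_gen (ideal_mul I I) m <->
  exists a b c d, [/\ e a b, e c d & m = two_edges_monom a b c d].
Proof.
split=> [[Im mmin]|[a [b [c [d [ab cd ->]]]]]].
  have [|a [b [c [d [ab cd dvd_m]]]]] := edge_ideal_square_msupp Im (m := m).
    by rewrite mem_msupp_mono.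
  exists a, b, c, d; split=> //.
  by rewrite (mmin _ (two_edges_in_square ab cd) dvd_m).
split=> [|m' Im' [x Ex]]; first exact: two_edges_in_square.
have [|a' [b' [c' [d' [_ _ [y Em']]]]]] :=
  edge_ideal_square_msupp Im' (m := m'); first by rewrite mem_msupp_mono.
have := congr1 mdeg Ex; rewrite Em' !mdegM !mdegU => /eqP.
rewrite -[X in _ == X]addnA -[X in X == _]addn0 eqn_add2l eq_sym addn_eq0.
case/andP=> _.
by rewrite mdeg_eq0 => /eqP x1; rewrite Ex x1 mulm1.
Qed.

End SquareOfEdgeIdeal.

(** * Sets of polarized variables as pairs of vertex sets *)

Section Layers.
Variable V : finType.
Implicit Types (s : {set V * 'I_2}) (S T : {set V}).

(** Indices are shifted by one: [ord0] gives the vertices [v] with [v_1] in [s], and [ord_max] those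
    with [v_2] in [s]. *)
Definition layer s (j : 'I_2) : {set V} := [set v | (v, j) \in s].

Definition of_layers S T : {set V * 'I_2} :=
  [set w : V * 'I_2 | if w.2 == ord0 then w.1 \in S else w.1 \in T].

Lemma layer0_of_layers S T : layer (of_layers S T) ord0 = S.
Proof. by apply/setP => v; rewrite !inE. Qed.

Lemma layer1_of_layers S T : layer (of_layers S T) ord_max = T.
Proof. by apply/setP => v; rewrite !inE. Qed.

Lemma ord2_cases (j : 'I_2) : {j = ord0} + {j = ord_max}.
Proof.
by case: j => -[|[|//]] hj; [left | right]; apply: val_inj.
Qed.

Lemma sub_of_layers s S T :
  (s \subset of_layers S T) =
  (layer s ord0 \subset S) && (layer s ord_max \subset T).
Proof.
apply/subsetP/andP => [sST|[/subsetP sS /subsetP sT] [v j]].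
  by split; apply/subsetP => v; rewrite inE => /sST; rewrite inE.
rewrite !inE /=; case: (ord2_cases j) => -> vs; [apply: sS | apply: sT];
  by rewrite inE.
Qed.

Lemma of_layers_sub s S T :
  (of_layers S T \subset s) =
  (S \subset layer s ord0) && (T \subset layer s ord_max).
Proof.
apply/subsetP/andP => [STs|[/subsetP sS /subsetP sT] [v j]].
  by split; apply/subsetP => v vS; rewrite inE; apply: STs; rewrite inE.
rewrite !inE /=; case: (ord2_cases j) => -> /=.
  by move=> /sS; rewrite inE.
by move=> /sT; rewrite inE.
Qed.

Lemma card_layers s : #|s| = (#|layer s ord0| + #|layer s ord_max|)%N.
Proof.
pose F v j := ((v, j) \in s) : nat.
have E j : #|layer s j| = (\sum_v F v j)%N.
  rewrite -sum1_card big_mkcond; apply: eq_bigr => v _.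
  by rewrite inE /F; case: (_ \in s).
transitivity (\sum_v \sum_j F v j)%N.
  rewrite pair_bigA -sum1_card big_mkcond.
  by apply: eq_bigr => -[v j] _; rewrite /F /=; case: (_ \in s).
rewrite !E -big_split; apply: eq_bigr => v _.
by rewrite big_ord_recl big_ord1; congr (_ + F v _)%N; apply: val_inj.
Qed.

End Layers.

(** * Independent sets of maximum size *)

Section IndependentSets.
Variables (V : finType) (e : rel V).
Implicit Types S T : {set V}.

Lemma independentP S :
  reflect {in S &, forall v w, ~~ e v w} (independent e S).
Proof.
apply: (iffP forall_inP) => [eS v w vS wS|eS v vS].
  by have /forall_inP := eS v vS; apply.
by apply/forall_inP => w; apply: eS.
Qed.

Lemma independent_card S : independent e S -> (#|S| <= independence_number e)%N.
Proof. by move=> iS; apply: (bigmax_sup S). Qed.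

Lemma maximum_independent_set :
  exists2 S, maxset (independent e) S & #|S| = independence_number e.
Proof.
have i0 : independent e set0 by apply/independentP => v w; rewrite inE.
have [|S iS ES] := eq_bigmax_cond (fun S => #|S|) (A := independent e).
  by apply/card_gt0P; exists set0.
exists S; last by rewrite /independence_number ES.
apply/maxsetP; split=> // T iT ST; apply/esym/eqP.
by rewrite eqEcard ST -ES; apply: independent_card.
Qed.

End IndependentSets.

(** * Faces and facets of the complex *)

Section SquareComplex.
Variables (K : fieldType) (V : finType) (e : rel V).
Hypotheses (e_sym : symmetric e) (e_irr : irreflexive e).
Implicit Types (s t : {set V * 'I_2}) (S T : {set V}).

Local Notation Gamma := (polarized_square_complex e K).
Local Notation lower s := (layer s ord0).
Local Notation upper s := (layer s ord_max).
Local Notation core s := (lower s :&: upper s).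

Lemma square_faceP s :
  reflect (forall a b c d, e a b -> e c d ->
             ~~ (polar_support 2 (two_edges_monom a b c d) \subset s))
          (s \in Gamma).
Proof.
rewrite inE; apply: (iffP (asboolP _)) => [nJ a b c d ab cd|h].
  apply/negP => sub; apply: nJ; apply/polarization_squarefreeP.
  exists (two_edges_monom a b c d) => //.
  by apply/min_mono_gen_squareP; exists a, b, c, d.
case/polarization_squarefreeP=> m /min_mono_gen_squareP[a [b [c [d [ab cd ->]]]]].
exact/negP/h.
Qed.

(** In the polarized product of two edges, [v_1] occurs iff [v] lies on at least one of them, and
    [v_2] iff [v] lies on both. When all ends are in the lower layer, a variable missing from [s]
    must therefore be [v_2] for a common vertex [v]. *)
Lemma face_layersP s :
  s \in Gamma <->
  (forall a b c d, e a b -> e c d ->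
     a \in lower s -> b \in lower s -> c \in lower s -> d \in lower s ->
   exists v, [/\ v \in [:: a; b], v \in [:: c; d] & v \notin upper s]).
Proof.
have neq a b : e a b -> a != b by apply: contraTneq => ->; rewrite e_irr.
split=> [/square_faceP sG a b c d ab cd|h].
  move=> a1 b1 c1 d1; have /subsetPn[[v j]] := sG a b c d ab cd.
  rewrite inE two_edges_monomE /= => jv vjs.
  have sub_lower x y : x \in lower s -> y \in lower s -> v \in [:: x; y] ->
      v \in lower s.
    by move=> x1 y1; rewrite !in_cons orbF => /orP[]/eqP->.
  have le_mem x y : e x y -> ((x == v) + (y == v) <= (v \in [:: x; y]))%N.
    move/neq; rewrite !in_cons orbF ![v == _]eq_sym.
    by case: (eqVneq x v) => [->|_]; case: (eqVneq y v).
  have := leq_trans jv (leq_add (le_mem _ _ ab) (le_mem _ _ cd)).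
  have [j0|j1] := ord2_cases j; subst j => /=.
    suff v1 : v \notin lower s.
      by rewrite (negbTE (contra (sub_lower _ _ a1 b1) v1))
                 (negbTE (contra (sub_lower _ _ c1 d1) v1)).
    by rewrite inE.
  case vab: (v \in [:: a; b]); case vcd: (v \in [:: c; d]) => // _.
  by exists v; rewrite vab vcd inE.
apply/square_faceP => a b c d ab cd; apply/negP => /subsetP sub.
have mem_s v (j : 'I_2) : (j < two_edges_monom a b c d v)%N -> (v, j) \in s.
  by move=> jv; apply: sub; rewrite inE.
have [||||v [vab vcd]] := h a b c d ab cd; rewrite ?inE ?mem_s //;
  rewrite ?two_edges_monomE ?eqxx ?addnS ?addSn //.
(* A common vertex has exponent at least 2, so its second copy would be in [s]. *)
move: vab vcd; rewrite !inE ![v == _]eq_sym.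
by case/orP=> /eqP->; case/orP=> /eqP->; rewrite !eqxx ?addnS ?addSn.
Qed.

Lemma edgeless_face S T : independent e S -> of_layers S T \in Gamma.
Proof.
move=> /independentP iS; apply/face_layersP => a b c d ab _.
by rewrite layer0_of_layers => aS bS; have := iS _ _ aS bS; rewrite ab.
Qed.

(** An edge inside the core, paired with itself, would need an end outside the upper layer. *)
Lemma core_independent s : s \in Gamma -> independent e (core s).
Proof.
move=> /face_layersP sG; apply/independentP => v w.
rewrite !in_setI => /andP[v1 v2] /andP[w1 w2]; apply/negP => vw.
have [x [+ _]] := sG v w v w vw vw v1 w1 v1 w1.
by rewrite !in_cons orbF => /orP[]/eqP->; rewrite ?v2 ?w2.
Qed.

Lemma card_lower_upper s : #|s| = (#|lower s :|: upper s| + #|core s|)%N.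
Proof. by rewrite card_layers cardsUI. Qed.

Lemma card_face s : s \in Gamma -> (#|s| <= #|V| + independence_number e)%N.
Proof.
move=> sG; rewrite card_lower_upper leq_add ?max_card //.
exact/independent_card/core_independent.
Qed.

(** The form in which maximality is used: to constrain a facet, enlarge one of its layers and check
    that the result is still a face. *)
Lemma facet_maximal s S T : facet Gamma s -> of_layers S T \in Gamma ->
  lower s \subset S -> upper s \subset T -> S = lower s /\ T = upper s.
Proof.
case/maxsetP=> _ smax STG sS sT.
have <- := smax _ STG; last by rewrite sub_of_layers sS.
by rewrite layer0_of_layers layer1_of_layers.
Qed.

(** Under a full upper layer the core is the whole lower layer, so any larger face has an
    independent lower layer containing [S]. *)
Lemma facet_of_independent S :
  maxset (independent e) S -> facet Gamma (of_layers S setT).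
Proof.
case/maxsetP=> iS Smax; apply/maxsetP; split=> [|t tG].
  exact: edgeless_face.
rewrite of_layers_sub => /andP[St Tt].
have t1 : upper t = setT by apply/eqP; rewrite -subTset.
have t0 : lower t = S.
  by apply: Smax St; have := core_independent tG; rewrite t1 setIT.
by apply/eqP; rewrite eqEsubset sub_of_layers of_layers_sub t0 t1 !subxx.
Qed.

(** * The dimension formula *)

Lemma card_of_independent S : #|of_layers S setT| = (#|V| + #|S|)%N.
Proof.
by rewrite card_layers layer0_of_layers layer1_of_layers cardsT addnC.
Qed.

Lemma square_complex_dim :
  complex_dim Gamma = #|V|%:Z + (independence_number e)%:Z - 1.
Proof.
rewrite /complex_dim -PoszD; congr (Posz _ - 1); apply/eqP.
rewrite eqn_leq; apply/andP; split.
  by apply/bigmax_leqP => s; apply: card_face.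
have [S Smax <-] := maximum_independent_set e.
have /maxsetp SG := facet_of_independent Smax.
by rewrite -card_of_independent (bigmax_sup (of_layers S setT)).
Qed.

(** * Facets of triangle-free graphs *)

Lemma facet_covers s : facet Gamma s -> lower s :|: upper s = setT.
Proof.
move=> sF; have /maxsetp/face_layersP sG := sF.
have [|||_ Es] := @facet_maximal s (lower s) (upper s :|: ~: lower s) sF.
(* The face condition only concerns edges inside the lower layer, so vertices outside that layer can
   be added freely to the upper one. *)
- apply/face_layersP; rewrite layer0_of_layers layer1_of_layers.
  move=> a b c d ab cd a1 b1 c1 d1.
  have [x [xab xcd x2]] := sG _ _ _ _ ab cd a1 b1 c1 d1; exists x; split=> //.
  rewrite in_setU in_setC negb_or x2 negbK.
  by move: xab; rewrite !in_cons orbF => /orP[]/eqP->.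
- exact: subxx.
- exact: subsetUl.
by rewrite -Es setUCA setUCr setUT.
Qed.

(** Pairwise meeting edges without a triangle form a star. Everything but its centre can then be put
    into the upper layer, and everything at all if the lower layer has no edge. *)
Lemma triangle_free_facet_center s : ~ has_triangle e -> facet Gamma s ->
  {in ~: upper s &, forall u v, u = v}.
Proof.
move=> notri sF; have /maxsetp/face_layersP sG := sF.
have [i1|ni1] := boolP (independent e (lower s)).
  have [||_ <-] := facet_maximal sF (edgeless_face setT i1).
  - exact: subxx.
  - exact: subsetT.
  by move=> u v; rewrite !inE.
suff [p p2 pstar] : exists2 p, p \notin upper s & forall c d,
    e c d -> c \in lower s -> d \in lower s -> p \in [:: c; d].
  have [|||_ <-] := @facet_maximal s (lower s) [set~ p] sF.
  - apply/face_layersP; rewrite layer0_of_layers layer1_of_layers.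
    move=> a b c d ab cd a1 b1 c1 d1.
    by exists p; rewrite (pstar a b) ?(pstar c d) // !inE eqxx.
  - exact: subxx.
  - by apply/subsetP => v v2; rewrite !inE; apply: contraTneq v2 => ->.
  by move=> u v; rewrite !inE !negbK => /eqP-> /eqP->.
have [a [b [ab a1 b1 a2]]] : exists a b,
    [/\ e a b, a \in lower s, b \in lower s & a \notin upper s].
  (* Pairing the edge with itself yields an end outside the upper layer, which is named [a]. *)
  case/forall_inPn: ni1 => a a1 /forall_inPn[b b1 /negPn ab].
  have [x [+ _]] := sG a b a b ab ab a1 b1 a1 b1.
  rewrite !in_cons orbF => /orP[]/eqP-> x2; first by exists a, b.
  by exists b, a; rewrite e_sym.
(* A star centred at neither end of [ab] has an edge [{b, y}] avoiding [a]
   and an edge [{a, z}] avoiding [b]; these meet, so [y = z] and [{a, b, y}] is a triangle. *)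
have avoid p q : e p q -> p \in lower s -> q \in lower s ->
    (forall c d, e c d -> c \in lower s -> d \in lower s -> p \in [:: c; d]) \/
    (exists y, [/\ e q y, y \in lower s, y != p & q \notin upper s]).
  move=> pq p1 q1; have [all_p|] := pselect (forall c d,
    e c d -> c \in lower s -> d \in lower s -> p \in [:: c; d]); first by left.
  move=> nall; right; apply: contrapT => noy; apply: nall => c d cd c1 d1.
  apply: contrapT => /negP; rewrite !in_cons orbF negb_or => /andP[pc pd].
  have [x [+ +]] := sG p q c d pq cd p1 q1 c1 d1.
  rewrite !in_cons !orbF => /orP[]/eqP->.
    by rewrite (negbTE pc) (negbTE pd).
  case/orP=> /eqP Eq q2; apply: noy.
    by exists d; rewrite Eq -Eq q2 Eq (eq_sym d).
  by exists c; rewrite q2 Eq e_sym (eq_sym c).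
have [a_all|[y [by_ y1 ya b2]]] := avoid a b ab a1 b1; first by exists a.
have ba : e b a by rewrite e_sym.
(* Here [b2], obtained from the edge avoiding [a], makes [b] an admissible centre. *)
have [b_all|[z [az z1 zb _]]] := avoid b a ba b1 a1; first by exists b.
have [x [+ + _]] := sG _ _ _ _ by_ az b1 y1 a1 z1.
rewrite !in_cons !orbF => /orP[]/eqP->.
  rewrite (eq_sym b z) (negbTE zb) orbF => /eqP Eba.
  by rewrite Eba e_irr in ba.
rewrite (negbTE ya) => /eqP Eyz; case: notri.
by exists a, b, y; rewrite ab by_ Eyz az.
Qed.

(** If a vertex [v] could be added to the core, some layer could be enlarged: the upper one if [v]
    is in the lower layer, the lower one otherwise. *)
Lemma triangle_free_facet_core s : ~ has_triangle e -> facet Gamma s ->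
  maxset (independent e) (core s).
Proof.
move=> notri sF; have /maxsetp sG := sF.
have uniq2 := triangle_free_facet_center notri sF.
apply/maxsetP; split=> [|B /independentP iB sB]; first exact: core_independent.
apply/eqP; rewrite eqEsubset sB andbT; apply/subsetP => v vB.
apply: contraT => vcore.
have nocore w : e v w -> w \in lower s -> w \notin upper s.
  move=> vw w1; apply/negP => w2; suff : ~~ e v w by rewrite vw.
  by apply: iB => //; apply: (subsetP sB); rewrite inE w1 w2.
have : v \in lower s :|: upper s by rewrite facet_covers ?inE.
have /face_layersP {}sG := sG.
rewrite in_setU; case: (boolP (v \in lower s)) => [v1 _|v1 /= v2].
  have v2 : v \notin upper s by move: vcore; rewrite in_setI v1.
  (* Now [v] is the only vertex outside the upper layer. Every edge inside the lower layer must
     contain it, yet a neighbour of [v] there would also be outside the upper layer. *)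
  suff i1 : independent e (lower s).
    have [||_ E2] := facet_maximal sF (edgeless_face setT i1).
    - exact: subxx.
    - exact: subsetT.
    by rewrite -E2 inE in v2.
  have nov w : w \in lower s -> ~~ e v w.
    move=> w1; apply/negP => vw; have w2 := nocore w vw w1.
    have Evw : v = w by apply: uniq2; rewrite in_setC.
    by rewrite Evw e_irr in vw.
  apply/independentP => a b a1 b1; apply/negP => ab.
  have [x [+ _ x2]] := sG a b a b ab ab a1 b1 a1 b1.
  have -> : x = v by apply: uniq2; rewrite in_setC.
  rewrite !in_cons orbF => /orP[]/eqP Ev; subst.
    by have := nov b b1; rewrite ab.
  by have := nov a a1; rewrite e_sym ab.
(* After adding [v], every edge inside the lower layer still has an end outside the upper layer; by
   [uniq2] this end is the same vertex for all edges. *)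
have [|||E1 _] := @facet_maximal s (v |: lower s) (upper s) sF.
- apply/face_layersP; rewrite layer0_of_layers layer1_of_layers.
  have meets a b : e a b -> a \in v |: lower s -> b \in v |: lower s ->
      exists2 x, x \in [:: a; b] & x \notin upper s.
    move=> ab; rewrite !in_setU1 => /predU1P[Ea|a1] /predU1P[Eb|b1].
    + by rewrite Ea Eb e_irr in ab.
    + by exists b; rewrite ?in_cons ?eqxx ?orbT // nocore // -Ea.
    + by exists a; rewrite ?in_cons ?eqxx // nocore // -Eb e_sym.
    by have [x [xab _ x2]] := sG a b a b ab ab a1 b1 a1 b1; exists x.
  move=> a b c d ab cd a1 b1 c1 d1.
  have [x xab x2] := meets a b ab a1 b1; have [y ycd y2] := meets c d cd c1 d1.
  exists x; split=> //.
  by have -> : x = y by apply: uniq2; rewrite in_setC.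
- exact: subsetUr.
- exact: subxx.
by move: v1; rewrite -E1 setU11.
Qed.

(** * A triangle yields a facet of less than maximum size *)

Lemma triangle_small_facet : has_triangle e ->
  exists2 s, facet Gamma s & (#|s| < #|V| + independence_number e)%N.
Proof.
case=> a [b [c [ab bc ac]]].
have ne x y : e x y -> x != y by apply: contraTneq => ->; rewrite e_irr.
have [nab nbc nac] := And3 (ne _ _ ab) (ne _ _ bc) (ne _ _ ac).
pose D := [set x in [:: a; b; c]].
have DG : of_layers D (~: D) \in Gamma.
  apply/face_layersP; rewrite layer0_of_layers layer1_of_layers.
  move=> w x y z /ne wx /ne yz wD xD yD zD.
  suff [v vwx vyz] : exists2 v, v \in [:: w; x] & v \in [:: y; z].
    exists v; split=> //; rewrite in_setC negbK.
    by move: vwx; rewrite !in_cons orbF => /orP[]/eqP->.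
  (* Two disjoint edges would need four vertices. *)
  have cardD : (#|D| <= 3)%N by rewrite cardsE; apply: card_size.
  apply: contrapT => nov.
  have : uniq [:: w; x; y; z].
    rewrite /= !inE !negb_or wx yz !andbT /= -andbA; apply/and4P; split.
    + by apply/eqP => E; apply: nov; exists w; rewrite !inE E eqxx.
    + by apply/eqP => E; apply: nov; exists w; rewrite !inE E eqxx ?orbT.
    + by apply/eqP => E; apply: nov; exists x; rewrite !inE E eqxx ?orbT.
    + by apply/eqP => E; apply: nov; exists x; rewrite !inE E eqxx ?orbT.
  move=> /card_uniqP card4; suff: (4 <= #|D|)%N by rewrite leqNgt ltnS cardD.
  rewrite -[4%N]card4; apply/subset_leq_card/subsetP => v.
  by rewrite !in_cons orbF => /or4P[]/eqP->.
have [s sF] := maxset_exists DG.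
rewrite of_layers_sub => /andP[/subsetP D1 _]; exists s => //.
have sG := maxsetp sF.
have a1 : a \in lower s by apply: D1; rewrite !inE eqxx.
have b1 : b \in lower s by apply: D1; rewrite !inE eqxx orbT.
have c1 : c \in lower s by apply: D1; rewrite !inE eqxx !orbT.
have /face_layersP meet := sG.
have ba : e b a by rewrite e_sym.
have ca : e c a by rewrite e_sym.
have cb : e c b by rewrite e_sym.
(* The edges [xy] and [xz] share only [x], so [x] itself must avoid the upper layer. *)
have off x y z : e x y -> e x z -> y != z -> x \in lower s -> y \in lower s ->
    z \in lower s -> x \notin upper s.
  move=> xy xz nyz x1 y1 z1.
  have [v [+ + v2]] := meet _ _ _ _ xy xz x1 y1 x1 z1.
  rewrite !in_cons !orbF => /orP[]/eqP E; first by rewrite -E.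
  by rewrite E (negbTE nyz) orbF eq_sym (negbTE (ne _ _ xy)).
have a2 : a \notin upper s by apply: (off a b c).
(* The union of the layers has at most [#|V|] elements, so it suffices to extend the independent
   core by one vertex, namely [a]. *)
rewrite card_lower_upper -addnS leq_add ?max_card //.
have -> : #|core s|.+1 = #|a |: core s|.
  by rewrite cardsU1 in_setI (negbTE a2) andbF.
apply: independent_card.
have iC := independentP _ _ (core_independent sG).
(* The edge [aw] can meet [bc] only in [w], which lies in the upper layer. *)
have noa w : w \in core s -> ~~ e a w.
  rewrite in_setI => /andP[w1 w2]; apply/negP => aw.
  have [v [+ +]] := meet _ _ _ _ aw bc a1 w1 b1 c1.
  rewrite !in_cons !orbF => /orP[]/eqP->; last by rewrite w2.
  by rewrite (negbTE nab) (negbTE nac).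
apply/independentP => v w; rewrite !in_setU1.
case/predU1P=> [->|vC] /predU1P[->|wC]; rewrite ?e_irr ?noa //.
  by rewrite e_sym noa.
exact: iC.
Qed.

(** * The purity criterion and the conclusion *)

Lemma pure_squareP : pure Gamma <-> unmixed e /\ ~ has_triangle e.
Proof.
split=> [purG|[unmix notri] s t sF tF].
  split=> [S T /facet_of_independent SF /facet_of_independent TF|tri].
    by have := purG _ _ SF TF; rewrite !card_of_independent => /addnI.
  have [s sF] := triangle_small_facet tri.
  have [S /facet_of_independent SF <-] := maximum_independent_set e.
  by rewrite -card_of_independent (purG _ _ sF SF) ltnn.
(* The layers of a facet cover [V], so its size is determined by that of its core. *)
rewrite !card_lower_upper !facet_covers //; congr (_ + _)%N.
by apply: unmix; apply: triangle_free_facet_core.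
Qed.

End SquareComplex.

Theorem theorem2p5 (K : fieldType) (V : finType) (e : rel V) (n : nat)
    (G_simple : simple_graph e) (G_noisol : no_isolated_vertex e)
    (card_V : #|V| = n) (n_ge1 : (1 <= n)%N) :
  let Gamma := polarized_square_complex e K in
  [/\ n%:Z <= complex_dim Gamma,
      pure Gamma <-> (unmixed e /\ ~ has_triangle e) &
      pure Gamma ->
        complex_dim Gamma = n%:Z + (independence_number e)%:Z - 1].
Proof.
have [e_sym e_irr] := G_simple.
have dimG := square_complex_dim K e_irr; rewrite -card_V /= dimG.
split=> //; last exact: pure_squareP.
have /card_gt0P[v _] : (0 < #|V|)%N by rewrite card_V.
(* A single vertex is independent, so the independence number makes up for the [- 1]. *)
rewrite -addrA lerDl subr_ge0 lez_nat -(cards1 v); apply: independent_card.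
by apply/independentP => x y /set1P-> /set1P->; rewrite e_irr.
Qed.
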